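(* Let $A$ be a real $m\times n$ matrix and $B$ a real $n\times\rho$ matrix, let $\Theta^{(\kappa)}=\{\Theta^{(\kappa)}_1,\ldots,\Theta^{(\kappa)}_k\}$ be a partition of $\{1,\ldots,n\}$ with $|\Theta^{(\kappa)}|=k$, and let $p=(p_\ell)_{\ell=1}^k$ be a sampling probability on it. For a fixed integer $c\ge1$ let $$\hat S=\frac1c\sum_{i=1}^c\frac1{p_{r_i}}A_{(,\Theta^{(\kappa)}_{r_i})}B_{(\Theta^{(\kappa)}_{r_i},)},$$ where $r_1,\ldots,r_c$ are independent samples from $\{1,\ldots,k\}$ drawn according to $p$. Then for any $\epsilon>0$, $$\mathbb{P}_p\big(\|\hat S-AB\|_2>\epsilon\big)\le(m+\rho)\exp\Big(-\frac{c\epsilon^2}{2\big(\|AB\|_2^2+2M\|AB\|_2+\mathcal{U}_2(p)\big)+\epsilon\big(\|AB\|_2+\mathcal{U}_1(p)\big)}\Big),$$ where $$M:=\sum_{\ell=1}^k\big\|A_{(,\Theta^{(\kappa)}_\ell)}B_{(\Theta^{(\kappa)}_\ell,)}\big\|_F,\quad \mathcal{U}_1(p):=\max_{1\le r\le k}\frac1{p_r}\big\|A_{(,\Theta^{(\kappa)}_r)}B_{(\Theta^{(\kappa)}_r,)}\big\|_F,\quad \mathcal{U}_2(p):=\sum_{\ell=1}^k\frac1{p_\ell}\big\|A_{(,\Theta^{(\kappa)}_\ell)}B_{(\Theta^{(\kappa)}_\ell,)}\big\|_F^2.$$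
   Context: A partition of $\{1,\ldots,n\}$ is into nonempty disjoint blocks $\Theta^{(\kappa)}_\ell$ of indices. A sampling probability on a partition with $k$ blocks is a vector $p=(p_\ell)_{\ell=1}^k$ with all $p_\ell>0$ and $\sum_{\ell=1}^k p_\ell=1$; index $\ell$ is drawn with probability $p_\ell$. $A_{(,\Theta^{(\kappa)}_\ell)}$ is the matrix formed by the columns of $A$ with indices in $\Theta^{(\kappa)}_\ell$, and $B_{(\Theta^{(\kappa)}_\ell,)}$ is the matrix formed by the rows of $B$ with indices in $\Theta^{(\kappa)}_\ell$ (same ordering of indices). $\|\cdot\|_F$ is the Frobenius norm and $\|\cdot\|_2$ the spectral norm (operator norm induced by the Euclidean norm). $\mathbb{P}_p$ denotes probability under $p$. *)

(* Defs.v *)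
(* MathComp / MathComp-Analysis. *)
From HB Require Import structures.
From mathcomp Require Import all_boot all_order all_algebra.
From mathcomp Require Import all_classical all_reals all_analysis.

Set Implicit Arguments.
Unset Strict Implicit.
Unset Printing Implicit Defensive.

Import Order.TTheory GRing.Theory Num.Theory.

Local Open Scope ring_scope.

(* The blocks are indexed by 'I_k; injectivity says that there are exactly k of
   them. *)
Definition block_partition (n k : nat) (Theta : 'I_k -> {set 'I_n}) : Prop :=
  injective Theta /\ finset.partition (Theta @: 'I_k) [set: 'I_n]%SET.

Definition sampling_prob (R : realType) (k : nat) (p : 'I_k -> R) : Prop :=
  (forall l, 0 < p l) /\ \sum_(l < k) p l = 1.

(* The indices of S are enumerated in increasing order by enum_val, in both
   colblock and rowblock. *)
Definition colblock (R : realType) (m n : nat) (A : 'M[R]_(m, n))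
    (S : {set 'I_n}) : 'M[R]_(m, #|S|) :=
  colsub (fun j : 'I_#|S| => enum_val j) A.

Definition rowblock (R : realType) (n rho : nat) (B : 'M[R]_(n, rho))
    (S : {set 'I_n}) : 'M[R]_(#|S|, rho) :=
  rowsub (fun i : 'I_#|S| => enum_val i) B.

Definition blockprod (R : realType) (m n rho : nat) (A : 'M[R]_(m, n))
    (B : 'M[R]_(n, rho)) (S : {set 'I_n}) : 'M[R]_(m, rho) :=
  colblock A S *m rowblock B S.

(* The library's norm `|M| on matrices is the entrywise maximum, hence these. *)
Definition frob_norm (R : realType) (m n : nat) (M : 'M[R]_(m, n)) : R :=
  Num.sqrt (\sum_(i < m) \sum_(j < n) M i j ^+ 2).

Definition eucl_norm (R : realType) (n : nat) (x : 'cV[R]_n) : R :=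
  Num.sqrt (\sum_(i < n) x i ord0 ^+ 2).

(* The supremum is over the closed unit ball rather than the sphere, so that
   the set is nonempty also when n = 0. *)
Definition spec_norm (R : realType) (m n : nat) (M : 'M[R]_(m, n)) : R :=
  sup [set eucl_norm (M *m x) | x in [set x : 'cV[R]_n | eucl_norm x <= 1]]%classic.

Definition Shat (R : realType) (m n rho k c : nat) (A : 'M[R]_(m, n))
    (B : 'M[R]_(n, rho)) (Theta : 'I_k -> {set 'I_n}) (p : 'I_k -> R)
    (r : 'I_c -> 'I_k) : 'M[R]_(m, rho) :=
  c%:R^-1 *: \sum_(i < c) (p (r i))^-1 *: blockprod A B (Theta (r i)).

Definition Msum (R : realType) (m n rho k : nat) (A : 'M[R]_(m, n))
    (B : 'M[R]_(n, rho)) (Theta : 'I_k -> {set 'I_n}) : R :=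
  \sum_(l < k) frob_norm (blockprod A B (Theta l)).

(* All terms are nonnegative, so the default value 0 does not affect the
   maximum when 0 < k. *)
Definition U1 (R : realType) (m n rho k : nat) (A : 'M[R]_(m, n))
    (B : 'M[R]_(n, rho)) (Theta : 'I_k -> {set 'I_n}) (p : 'I_k -> R) : R :=
  \big[Num.max/0]_(l < k) ((p l)^-1 * frob_norm (blockprod A B (Theta l))).

Definition U2 (R : realType) (m n rho k : nat) (A : 'M[R]_(m, n))
    (B : 'M[R]_(n, rho)) (Theta : 'I_k -> {set 'I_n}) (p : 'I_k -> R) : R :=
  \sum_(l < k) (p l)^-1 * frob_norm (blockprod A B (Theta l)) ^+ 2.

(* Independent samples r_0, ..., r_(c-1) from p on a probability space: random
   variables into 'I_k with its discrete sigma-algebra, each of law p, and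
   mutually independent (product rule over every subfamily J). *)
Definition iid_samples (d : measure_display) (T : measurableType d)
    (R : realType) (P : probability T R) (k c : nat) (p : 'I_k -> R)
    (r : 'I_c -> T -> 'I_k) : Prop :=
  [/\ forall i (E : set 'I_k), measurable (r i @^-1` E)%classic,
      forall i l, P (r i @^-1` [set l])%classic = (p l)%:E
    & forall (J : {set 'I_c}) (E : 'I_c -> set 'I_k),
        P (\bigcap_(i in [set` J]) (r i @^-1` E i))%classic =
        (\prod_(i in J) P (r i @^-1` E i)%classic)%E ].

(* Main.v *)
Require Import Defs.
From mathcomp Require Import all_boot all_order all_algebra.
From mathcomp Require Import all_classical all_reals all_analysis.
From mathcomp Require Import ring lra.

Import Order.TTheory GRing.Theory Num.Theory.

Local Open Scope ring_scope.

(** The spectral norm is at most the Frobenius norm, and the latter comes from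
    an inner product.  So the theorem follows from a Bernstein inequality for
    sums of independent centred vectors of a Euclidean space, whose dimensional
    factor is the constant 2.  That constant is at most [m + rho] as soon as
    both dimensions are positive, and when one of them is 0 the matrices vanish
    and there is no deviation at all.

    The vector inequality is obtained, following Pinelis, from the function
    [cosh |x|], where [|x|] is the Frobenius norm.  Adding an independent centred
    vector [Z] to [x] multiplies the mean of this function by at most
    [1 + E (exp |Z| - 1 - |Z|)].
    The reason is that
    [cosh |x + y| <= cosh |x| * (exp |y| - |y|) + (sinh |x| / |x|) * <x, y>],
    in which the last term is linear in [y] and so has mean 0
    ([cosh_frob_normD], [mean_cosh_iid_sum]).  That inequality is scalar: for
    fixed lengths of [x] and [y], [|x + y| ^ 2] is affine in the inner product,
    and [cosh (sqrt q)] is convex in [q] because its power series has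
    nonnegative coefficients ([cosh_sqrt_convex]).  One only has to check the
    two collinear configurations, where it reads [b <= sinh b].  Markov's
    inequality and [exp t - 1 - t <= (t ^ 2 / 2) / (1 - t / 3)] then give the
    Bernstein bound [2 * exp (- c eps ^ 2 / (2 * D))] whenever [b * eps / 3 < D]
    and [V + b * eps / 3 <= D], where [b] bounds the norms of the summands and [V]
    their second moment ([iid_sum_tail]).

    Write [a] for the Frobenius norm of [A B].  The centred samples satisfy
    [b = U1 + a] and [V = U2 - a ^ 2], and [a <= U1] because [A B] is the mean
    of the samples.  An error larger than [U1 + a] never occurs; for
    [eps < U1 + a] the gain [- a ^ 2] in the variance pays for the difference
    between [b / 3] and [U1 / 2], so that [D = U2 + eps * U1 / 2] is allowed
    ([importance_sampling_tail]).  The denominator of the theorem is at least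
    [2 * D], its terms in the spectral norm of [A B] being nonnegative. *)

Set Implicit Arguments.
Unset Strict Implicit.

(** * Hyperbolic functions and the exponential remainder *)

Section Hyperbolic.
Variable R : realType.
Import numFieldNormedType.Exports.
Local Open Scope classical_set_scope.
Implicit Types (a b r s t u v w x : R) (k : nat).

Definition cosh x := (expR x + expR (- x)) / 2.
Definition sinh x := (expR x - expR (- x)) / 2.

Lemma cosh_gt0 x : 0 < cosh x.
Proof. by rewrite /cosh divr_gt0 ?addr_gt0 ?expR_gt0. Qed.

Lemma cosh0 : cosh 0 = 1.
Proof. by rewrite /cosh oppr0 expR0; field. Qed.

Lemma coshN x : cosh (- x) = cosh x.
Proof. by rewrite /cosh opprK addrC. Qed.

Lemma coshDsinh x : cosh x + sinh x = expR x.
Proof. by rewrite /cosh /sinh; field. Qed.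

Lemma coshD x y : cosh (x + y) = cosh x * cosh y + sinh x * sinh y.
Proof. by rewrite /cosh /sinh opprD !expRD; field. Qed.

Lemma sinhN x : sinh (- x) = - sinh x.
Proof. by rewrite /sinh opprK; field. Qed.

Lemma sinh_le_cosh x : sinh x <= cosh x.
Proof. by rewrite /cosh /sinh; have := expR_ge0 (- x); lra. Qed.

Lemma expR_half_le_cosh x : expR x / 2 <= cosh x.
Proof. by rewrite /cosh; have := expR_ge0 (- x); lra. Qed.

Lemma le_cosh x y : 0 <= x -> x <= y -> cosh x <= cosh y.
Proof.
move=> x0 xy; rewrite /cosh !expRN.
have ex1 : 1 <= expR x by rewrite -expR0 ler_expR.
have exy : expR x <= expR y by rewrite ler_expR.
have ix0 : 0 <= (expR x)^-1 by rewrite invr_ge0 expR_ge0.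
have iy0 : 0 <= (expR y)^-1 by rewrite invr_ge0 expR_ge0.
have h : (expR y - expR x) * (1 - (expR x)^-1 * (expR y)^-1) >= 0.
  rewrite mulr_ge0 ?subr_ge0//.
  by rewrite mulr_ile1// invf_le1 ?expR_gt0// (le_trans ex1).
have -> : (expR x + (expR x)^-1) / 2 = (expR y + (expR y)^-1) / 2
   - (expR y - expR x) * (1 - (expR x)^-1 * (expR y)^-1) / 2.
  by field; rewrite !gt_eqF ?expR_gt0.
by lra.
Qed.

Lemma cvg_exp_series x : series (exp_coeff x) n @[n --> \oo] --> expR x.
Proof. exact: is_cvg_series_exp_coeff. Qed.

(** All terms of the power series of [exp b - exp (- b)] are nonnegative, and
    the one of degree 1 is [2 * b]. *)
Lemma le_sinh b : 0 <= b -> b <= sinh b.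
Proof.
move=> b0.
have c : (fun n => series (exp_coeff b) n - series (exp_coeff (- b)) n)
    @ \oo --> expR b - expR (- b).
  by apply: cvgB; exact: cvg_exp_series.
suff : 2 * b <= expR b - expR (- b) by rewrite /sinh; lra.
rewrite -(cvg_lim _ c)//; apply: limr_ge; first by apply/cvg_ex; eexists; exact: c.
exists 2%N => // n /= n2.
rewrite -(subnK n2) addn2 /series/= !big_nat_recl//.
rewrite /exp_coeff/= !expr0 !expr1 !fact0.
rewrite (_ : _ - _ = 2 * b + \sum_(0 <= i < n - 2)
    (b ^+ i.+2 / i.+2`!%:R - (- b) ^+ i.+2 / i.+2`!%:R)).
  rewrite lerDl sumr_ge0// => i _.
  rewrite -mulrBl divr_ge0// exprNn subr_ge0 -[leRHS]mul1r.
  rewrite ler_wpM2r ?exprn_ge0//.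
  by rewrite -signr_odd; case: odd => /=; rewrite ?expr0 ?expr1 ?lexx// lerN10.
rewrite sumrB (_ : 1`! = 1%N)//; lra.
Qed.

Lemma sinh_ge0 a : 0 <= a -> 0 <= sinh a.
Proof. by move=> a0; apply: le_trans (le_sinh a0). Qed.

Lemma exprn_convex (n : nat) w x y : 0 <= w -> w <= 1 -> 0 <= x -> 0 <= y ->
  (w * x + (1 - w) * y) ^+ n <= w * x ^+ n + (1 - w) * y ^+ n.
Proof.
move=> w0 w1 x0 y0; elim: n => [|n ih]; first by rewrite !expr0; lra.
rewrite !exprS.
have q0 : 0 <= w * x + (1 - w) * y by rewrite addr_ge0// mulr_ge0// subr_ge0.
apply: (le_trans (ler_wpM2l q0 ih)).
have h : 0 <= (x - y) * (x ^+ n - y ^+ n).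
  have [xy|yx] := leP x y.
    by rewrite -mulrNN !opprB mulr_ge0// subr_ge0// lerXn2r.
  by rewrite mulr_ge0// subr_ge0 ?lerXn2r// ltW.
have : 0 <= w * (1 - w) * ((x - y) * (x ^+ n - y ^+ n)).
  by rewrite mulr_ge0// mulr_ge0// subr_ge0.
by lra.
Qed.

(** Convexity of [q |-> cosh (sqrt q)], with [q] written as a square: the series
    [cosh r = \sum_j (r ^ 2) ^ j / (2 j)`!] is a sum of convex functions of
    [r ^ 2]. *)
Lemma cosh_sqrt_convex w r u v : 0 <= w -> w <= 1 ->
  r ^+ 2 = w * u ^+ 2 + (1 - w) * v ^+ 2 ->
  cosh r <= w * cosh u + (1 - w) * cosh v.
Proof.
move=> w0 w1 rE.
have c x : (fun n => series (exp_coeff x) n + series (exp_coeff (- x)) n)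
    @ \oo --> expR x + expR (- x).
  by apply: cvgD; exact: cvg_exp_series.
have cuv : (fun n => w * (series (exp_coeff u) n + series (exp_coeff (- u)) n)
      + (1 - w) * (series (exp_coeff v) n + series (exp_coeff (- v)) n)) @ \oo
    --> w * (expR u + expR (- u)) + (1 - w) * (expR v + expR (- v)).
  by apply: cvgD; apply: cvgM; [exact: cvg_cst|exact: c|exact: cvg_cst|exact: c].
suff : expR r + expR (- r) <= w * (expR u + expR (- u)) + (1 - w) * (expR v + expR (- v)).
  by rewrite /cosh; lra.
rewrite -(cvg_lim _ (c r))// -(cvg_lim _ cuv)//.
apply: ler_lim; [by apply/cvg_ex; eexists; exact: c|by apply/cvg_ex; eexists; exact: cuv|].
exists 0%N => // n _ /=.
rewrite /series /= -!big_split/= !mulr_sumr -big_split/=.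
apply: ler_sum => i _; rewrite /exp_coeff/= -!mulrDl !mulrA -!mulrDl.
apply: ler_wpM2r; first by rewrite invr_ge0.
have e x : x ^+ i + (- x) ^+ i = if odd i then 0 else 2 * (x ^+ 2) ^+ i./2.
  rewrite exprNn -signr_odd; case: ifPn => [_|/negPf oi].
    by rewrite expr1; ring.
  rewrite expr0 -exprM mul2n.
  rewrite (_ : i./2.*2 = i)%N; first by ring.
  by rewrite -[RHS]odd_double_half oi.
rewrite !e; case: odd; first by rewrite !mulr0 addr0.
rewrite rE; have := exprn_convex i./2 w0 w1 (sqr_ge0 u) (sqr_ge0 v).
by lra.
Qed.

(** Scalar form of the key inequality: [a] and [b] are the lengths of two vectors,
    [s] their inner product and [r] the length of their sum.  By
    [cosh_sqrt_convex] the left-hand side lies below the chord between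
    [cosh (a + b)] and [cosh (a - b)], and the right-hand side is affine in [s];
    at both ends the difference is [(cosh a -/+ sinh a) * (sinh b - b)].  For
    [a = 0] the coefficient [sinh a / a] takes the value 0, which is harmless
    since then [s = 0]. *)
Lemma cosh_add_le a b s r : 0 <= a -> 0 <= b -> `|s| <= a * b ->
  r ^+ 2 = a ^+ 2 + 2 * s + b ^+ 2 ->
  cosh r <= cosh a * (expR b - b) + sinh a / a * s.
Proof.
move=> a0 b0 sab rE.
(* [tau] is the cosine of the angle between the two vectors, taken to be 0
   when one of them vanishes. *)
have [tau [t1 t2 st]] : exists tau, [/\ -1 <= tau, tau <= 1 & s = tau * (a * b)].
  have [ab0|ab0] := eqVneq (a * b) 0.
    exists 0; split; [lra|lra|]; rewrite mul0r.
    by apply/eqP; rewrite -normr_le0 -ab0.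
  have abp : 0 < a * b by rewrite lt_neqAle eq_sym ab0 mulr_ge0.
  exists (s / (a * b)); split; last by rewrite divfK.
    by rewrite ler_pdivlMr// mulN1r lerNl (le_trans _ sab)// -normrN ler_norm.
  by rewrite ler_pdivrMr// mul1r (le_trans _ sab)// ler_norm.
have w0 : 0 <= (1 + tau) / 2 by lra.
have w1 : (1 + tau) / 2 <= 1 by lra.
have rw : r ^+ 2 = (1 + tau) / 2 * (a + b) ^+ 2 + (1 - (1 + tau) / 2) * (a - b) ^+ 2.
  by rewrite rE st; field.
have := cosh_sqrt_convex w0 w1 rw.
rewrite !coshD coshN sinhN => H; apply: (le_trans H).
have -> : sinh a / a * s = sinh a * tau * b.
  have [->|an] := eqVneq a 0; last by rewrite st; field.
  by rewrite /sinh oppr0 subrr !mul0r.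
rewrite -(coshDsinh b).
have sb : 0 <= sinh b - b by rewrite subr_ge0 le_sinh.
have h1 : 0 <= (cosh a - sinh a) * (sinh b - b).
  by rewrite mulr_ge0// subr_ge0 sinh_le_cosh.
have h2 : 0 <= sinh a * (sinh b - b) by rewrite mulr_ge0// sinh_ge0.
have : 0 <= (1 - tau) * (sinh a * (sinh b - b)) by rewrite mulr_ge0//; lra.
by lra.
Qed.

(** The series of the remainder is dominated by a geometric one, because
    [2 * 3 ^ j <= (j + 2)`!]. *)
Lemma expR_remainder_le t : 0 <= t -> t < 3 ->
  expR t - 1 - t <= t ^+ 2 / 2 / (1 - t / 3).
Proof.
move=> t0 t3; set q := t / 3.
have q0 : 0 <= q by rewrite divr_ge0.
have q1 : 0 < 1 - q by rewrite subr_gt0 ltr_pdivrMr// mul1r.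
suff : expR t <= 1 + t + t ^+ 2 / 2 / (1 - q) by lra.
rewrite -(cvg_lim _ (@cvg_exp_series t))//.
apply: limr_le; first exact: is_cvg_series_exp_coeff.
exists 2%N => // n /= n2; rewrite -(subnK n2) addn2.
set N := (n - 2)%N.
have : series (exp_coeff t) N.+2 <= 1 + t + t ^+ 2 / 2 * ((1 - q ^+ N) / (1 - q)).
  elim: N => [|N ih].
    rewrite /series/= !big_nat_recl// big_geq// /exp_coeff/= expr0 fact0 expr1.
    by rewrite (_ : 1`! = 1%N)// subrr mul0r mulr0 !divr1 !addr0.
  rewrite /series/= big_nat_recr//=; apply: (le_trans (lerD ih (lexx _))).
  rewrite -addrA lerD2l.
  have -> : (1 - q ^+ N.+1) / (1 - q) = (1 - q ^+ N) / (1 - q) + q ^+ N.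
    by rewrite exprS; field; rewrite gt_eqF.
  rewrite mulrDr lerD2l /exp_coeff/= -[N.+2]/(2 + N)%N exprD /q expr_div_n.
  have f : (2 * 3 ^ N <= (2 + N)`!)%N.
    elim: {ih}N => // N ih; rewrite addnS factS expnS mulnCA leq_mul//.
  rewrite (_ : _ / 2 * _ = t ^+ 2 * t ^+ N * (2^-1 * (3 ^+ N)^-1)); last first.
    by rewrite !mulrA; congr (_ / _); rewrite mulrAC.
  apply: ler_wpM2l; first by rewrite mulr_ge0// exprn_ge0.
  rewrite -invfM -natrX -natrM lef_pV2 ?ler_nat// posrE ltr0n ?fact_gt0//.
  by rewrite muln_gt0 expn_gt0.
move=> h; apply: (le_trans h); rewrite lerD2l.
apply: ler_wpM2l; first by rewrite divr_ge0// sqr_ge0.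
rewrite -[leRHS]mul1r ler_wpM2r ?invr_ge0 ?(ltW q1)//.
by rewrite gerBl exprn_ge0.
Qed.

End Hyperbolic.

(** * The Frobenius inner product and the two matrix norms *)

Section FrobeniusGeometry.
Variables (R : realType) (m n : nat).
Implicit Types (x y z : 'M[R]_(m, n)) (a : R).

Definition frob_dot x y : R := \sum_(i < m) \sum_(j < n) x i j * y i j.

Lemma frob_dotC x y : frob_dot x y = frob_dot y x.
Proof. by apply: eq_bigr => i _; apply: eq_bigr => j _; rewrite mulrC. Qed.

Lemma frob_dotDr x y z : frob_dot x (y + z) = frob_dot x y + frob_dot x z.
Proof.
rewrite /frob_dot -big_split; apply: eq_bigr => i _ /=.
by rewrite -big_split; apply: eq_bigr => j _; rewrite mxE mulrDr.
Qed.

Lemma frob_dotZr a x y : frob_dot x (a *: y) = a * frob_dot x y.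
Proof.
rewrite /frob_dot mulr_sumr; apply: eq_bigr => i _ /=.
by rewrite mulr_sumr; apply: eq_bigr => j _; rewrite mxE mulrCA.
Qed.

Lemma frob_dot0 x : frob_dot x 0 = 0.
Proof. by rewrite -(scale0r x) frob_dotZr mul0r. Qed.

Lemma frob_dot_sumr (I : finType) (F : I -> 'M[R]_(m, n)) x :
  frob_dot x (\sum_i F i) = \sum_i frob_dot x (F i).
Proof. by apply: (big_morph (frob_dot x)); [exact: frob_dotDr | exact: frob_dot0]. Qed.

Lemma frob_norm_ge0 x : 0 <= frob_norm x.
Proof. exact: sqrtr_ge0. Qed.

Lemma sqr_frob_norm x : frob_norm x ^+ 2 = frob_dot x x.
Proof.
rewrite /frob_norm sqr_sqrtr.
  by apply: eq_bigr => i _; apply: eq_bigr => j _; rewrite expr2.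
by apply: sumr_ge0 => i _; apply: sumr_ge0 => j _; exact: sqr_ge0.
Qed.

Lemma sqr_frob_normD x y :
  frob_norm (x + y) ^+ 2 = frob_norm x ^+ 2 + 2 * frob_dot x y + frob_norm y ^+ 2.
Proof.
rewrite !sqr_frob_norm frob_dotDr [frob_dot (x + y) x]frob_dotC.
by rewrite [frob_dot (x + y) y]frob_dotC !frob_dotDr [frob_dot y x]frob_dotC; ring.
Qed.

Lemma frob_normZ a x : frob_norm (a *: x) = `|a| * frob_norm x.
Proof.
apply/eqP; rewrite -(eqrXn2 (ltn0Sn 1)) ?mulr_ge0 ?frob_norm_ge0//.
by rewrite exprMn !sqr_frob_norm frob_dotZr frob_dotC frob_dotZr mulrA real_normK ?num_real.
Qed.

Lemma frob_norm0 : frob_norm (0 : 'M[R]_(m, n)) = 0.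
Proof. by rewrite -(scale0r 0) frob_normZ normr0 mul0r. Qed.

Lemma frob_normN x : frob_norm (- x) = frob_norm x.
Proof. by rewrite -scaleN1r frob_normZ normrN1 mul1r. Qed.

Lemma frob_norm0_eq0 x : frob_norm x = 0 -> x = 0.
Proof.
move=> x0; have : frob_norm x ^+ 2 = 0 by rewrite x0 expr0n.
rewrite sqr_frob_norm => /eqP.
rewrite psumr_eq0; last by move=> i _; apply: sumr_ge0 => j _; rewrite -expr2 sqr_ge0.
move=> /allP h; apply/matrixP => i j; rewrite mxE.
have := h i (mem_index_enum _); rewrite psumr_eq0; last by move=> l _; rewrite -expr2 sqr_ge0.
by move=> /allP /(_ j (mem_index_enum _)) /=; rewrite -expr2 sqrf_eq0 => /eqP.
Qed.

(** Cauchy-Schwarz: expand the square of the norm of [|y| x - |x| y]. *)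
Lemma frob_dot_le x y : frob_dot x y <= frob_norm x * frob_norm y.
Proof.
have [/frob_norm0_eq0 ->|xn] := eqVneq (frob_norm x) 0.
  by rewrite frob_dotC frob_dot0 mulr_ge0 ?frob_norm_ge0.
have [/frob_norm0_eq0 ->|yn] := eqVneq (frob_norm y) 0.
  by rewrite frob_dot0 mulr_ge0 ?frob_norm_ge0.
have xp : 0 < frob_norm x by rewrite lt_neqAle eq_sym xn frob_norm_ge0.
have yp : 0 < frob_norm y by rewrite lt_neqAle eq_sym yn frob_norm_ge0.
have := sqr_ge0 (frob_norm (frob_norm y *: x + (- frob_norm x) *: y)).
rewrite sqr_frob_normD !frob_normZ frob_dotZr frob_dotC frob_dotZr frob_dotC.
rewrite normrN !ger0_norm ?frob_norm_ge0// => h.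
rewrite -subr_ge0 -(pmulr_rge0 _ (mulr_gt0 xp yp)).
by move: h; lra.
Qed.

Lemma norm_frob_dot_le x y : `|frob_dot x y| <= frob_norm x * frob_norm y.
Proof.
rewrite ler_norml frob_dot_le andbT lerNl -mulN1r -frob_dotZr scaleN1r.
by rewrite -(frob_normN y) frob_dot_le.
Qed.

Lemma ler_frob_normD x y : frob_norm (x + y) <= frob_norm x + frob_norm y.
Proof.
rewrite -(ler_pXn2r (ltn0Sn 1)) ?nnegrE ?addr_ge0 ?frob_norm_ge0//.
by rewrite sqr_frob_normD; have := frob_dot_le x y; lra.
Qed.

Lemma ler_frob_norm_sum (I : finType) (F : I -> 'M[R]_(m, n)) :
  frob_norm (\sum_i F i) <= \sum_i frob_norm (F i).
Proof.
apply: (big_ind2 (fun x a => frob_norm x <= a)) => //.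
  by rewrite frob_norm0.
by move=> x a y b xa yb; apply: (le_trans (ler_frob_normD _ _)); exact: lerD.
Qed.

(** The reason for which [cosh] of the norm is a good potential: up to a term
    that is linear in [y], adding [y] costs a factor depending on the length of
    [y] only, and this factor is [1 + O(|y| ^ 2)]. *)
Lemma cosh_frob_normD x y :
  cosh (frob_norm (x + y)) <=
    cosh (frob_norm x) * (expR (frob_norm y) - frob_norm y)
    + sinh (frob_norm x) / frob_norm x * frob_dot x y.
Proof.
apply: cosh_add_le; rewrite ?frob_norm_ge0 ?norm_frob_dot_le//.
exact: sqr_frob_normD.
Qed.

End FrobeniusGeometry.

Section SpectralNorm.
Variable R : realType.

Lemma eucl_normE n (x : 'cV[R]_n) : eucl_norm x = frob_norm x.
Proof. by congr Num.sqrt; apply: eq_bigr => i _; rewrite big_ord1. Qed.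

(** Cauchy-Schwarz on each row of [M]. *)
Lemma eucl_norm_mulmx_le m n (M : 'M[R]_(m, n)) (x : 'cV[R]_n) :
  eucl_norm (M *m x) <= frob_norm M * eucl_norm x.
Proof.
rewrite !eucl_normE -(ler_pXn2r (ltn0Sn 1)) ?nnegrE ?mulr_ge0 ?frob_norm_ge0//.
rewrite exprMn [frob_norm (M *m x) ^+ 2]sqr_frob_norm [frob_norm M ^+ 2]sqr_frob_norm.
rewrite mulr_suml; apply: ler_sum => i _; rewrite big_ord1.
have -> : (M *m x) i ord0 = frob_dot (row i M)^T x.
  by rewrite mxE; apply: eq_bigr => j _; rewrite big_ord1 !mxE.
have -> : \sum_(j < n) M i j * M i j = frob_norm (row i M)^T ^+ 2.
  by rewrite sqr_frob_norm; apply: eq_bigr => j _; rewrite big_ord1 !mxE.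
rewrite -expr2 -exprMn -[leLHS](real_normK (num_real _)).
by rewrite ler_pXn2r ?nnegrE ?mulr_ge0 ?frob_norm_ge0// norm_frob_dot_le.
Qed.

Lemma spec_norm_le_frob m n (M : 'M[R]_(m, n)) : spec_norm M <= frob_norm M.
Proof.
apply: ge_sup.
  exists (eucl_norm (M *m 0)); exists 0 => //=.
  by rewrite eucl_normE frob_norm0 ler01.
move=> _ [x /= x1 <-]; apply: (le_trans (eucl_norm_mulmx_le _ _)).
by rewrite -[leRHS]mulr1 ler_wpM2l ?frob_norm_ge0.
Qed.

Lemma spec_norm_ge0 m n (M : 'M[R]_(m, n)) : 0 <= spec_norm M.
Proof.
apply: ub_le_sup.
  exists (frob_norm M) => _ [x /= x1 <-]; apply: (le_trans (eucl_norm_mulmx_le _ _)).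
  by rewrite -[leRHS]mulr1 ler_wpM2l ?frob_norm_ge0.
by exists 0; rewrite /= ?mulmx0 eucl_normE frob_norm0// ler01.
Qed.

End SpectralNorm.

(** * Sums of independent centred matrices *)

Section ProductExpectation.
Variables (R : realType) (K : finType).

Definition ffun_cons c (l : K) (f : {ffun 'I_c -> K}) : {ffun 'I_c.+1 -> K} :=
  [ffun i => if unlift ord0 i is Some j then f j else l].

Lemma ffun_cons0 c l (f : {ffun 'I_c -> K}) : ffun_cons l f ord0 = l.
Proof. by rewrite ffunE unlift_none. Qed.

Lemma ffun_cons_lift c l (f : {ffun 'I_c -> K}) i :
  ffun_cons l f (lift ord0 i) = f i.
Proof. by rewrite ffunE liftK. Qed.

(** Conditioning on the first of [c + 1] samples. *)
Lemma sum_ffun_ordS c (F : {ffun 'I_c.+1 -> K} -> R) :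
  \sum_f F f = \sum_l \sum_(f : {ffun 'I_c -> K}) F (ffun_cons l f).
Proof.
rewrite pair_big /= (reindex (fun lf => ffun_cons lf.1 lf.2))//=.
exists (fun g : {ffun 'I_c.+1 -> K} => (g ord0, [ffun j => g (lift ord0 j)])).
  move=> [l f] _ /=; rewrite ffun_cons0; congr (_, _).
  by apply/ffunP => j; rewrite ffunE ffun_cons_lift.
move=> g _; apply/ffunP => i /=; rewrite ffunE.
by case: unliftP => [j ->|->]; rewrite ?ffunE.
Qed.

Variables (m n : nat) (p : K -> R) (Z : K -> 'M[R]_(m, n)).
Hypothesis p0 : forall l, 0 <= p l.
Hypothesis pZ0 : \sum_l p l *: Z l = 0.

(** The supermartingale property of the potential, iterated over the samples.
    The starting point [x] is arbitrary so that the induction can absorb the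
    first sample into it. *)
Lemma mean_cosh_iid_sum c (x : 'M[R]_(m, n)) :
  \sum_(f : {ffun 'I_c -> K})
     (\prod_i p (f i)) * cosh (frob_norm (x + \sum_i Z (f i)))
  <= cosh (frob_norm x) * (\sum_l p l * (expR (frob_norm (Z l)) - frob_norm (Z l))) ^+ c.
Proof.
set q := \sum_l p l * _.
have q0 : 0 <= q.
  apply: sumr_ge0 => l _; apply: mulr_ge0; [exact: p0|rewrite subr_ge0].
  by apply: le_trans (expR_ge1Dx _); rewrite lerDr.
elim: c x => [|c ih] x.
  rewrite (bigD1 (ffun0 (card_ord 0)))//= [X in _ + X]big1.
    by rewrite !big_ord0 expr0 mul1r mulr1 !addr0.
  by move=> f /eqP []; apply/ffunP => -[].
rewrite sum_ffun_ordS.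
have step l : \sum_(f : {ffun 'I_c -> K}) (\prod_i p (ffun_cons l f i)) *
     cosh (frob_norm (x + \sum_i Z (ffun_cons l f i)))
   <= p l * (cosh (frob_norm (x + Z l)) * q ^+ c).
  apply: le_trans (ler_wpM2l (p0 l) (ih (x + Z l))).
  rewrite mulr_sumr; apply: ler_sum => f _.
  rewrite !big_ord_recl !ffun_cons0 -mulrA addrA.
  rewrite (eq_bigr (p \o f)) => [|i _]; last by rewrite ffun_cons_lift.
  by rewrite [in leLHS](eq_bigr (Z \o f)) => [|i _]; last by rewrite ffun_cons_lift.
apply: le_trans (ler_sum _ (fun l _ => step l)) _.
rewrite exprSr mulrA mulrAC.
under eq_bigr do rewrite mulrA.
rewrite -mulr_suml ler_wpM2r ?exprn_ge0//.
apply: le_trans (ler_sum _ (fun l _ => ler_wpM2l (p0 l) (cosh_frob_normD x (Z l)))) _.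
under eq_bigr do rewrite mulrDr.
rewrite big_split/= [X in _ + X](_ : _ = 0).
  rewrite addr0 mulr_sumr; apply/ler_sum => l _.
  by rewrite mulrCA.
transitivity (sinh (frob_norm x) / frob_norm x * frob_dot x (\sum_l p l *: Z l)).
  rewrite frob_dot_sumr mulr_sumr; apply: eq_bigr => l _.
  by rewrite frob_dotZr mulrCA.
by rewrite pZ0 frob_dot0 mulr0.
Qed.

End ProductExpectation.

Section Tail.
Variables (R : realType) (K : finType) (m n : nat) (p : K -> R).
Hypotheses (p0 : forall l, 0 <= p l) (p1 : \sum_l p l = 1).

(** Bernstein's inequality for Hilbert norms: Markov's inequality applied to
    [cosh (lam * |S|)], where [S] is the sum of the samples.  The factor 2 comes
    from [exp x / 2 <= cosh x]. *)
Lemma iid_sum_tail (Z : K -> 'M[R]_(m, n)) c (V b D eps : R) :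
  \sum_l p l *: Z l = 0 -> 0 <= b -> (forall l, frob_norm (Z l) <= b) ->
  \sum_l p l * frob_norm (Z l) ^+ 2 <= V ->
  0 < eps -> b * eps / 3 < D -> V + b * eps / 3 <= D ->
  \sum_(f : {ffun 'I_c -> K} | c%:R * eps < frob_norm (\sum_i Z (f i)))
     \prod_i p (f i) <= 2 * expR (- (c%:R * eps ^+ 2 / (2 * D))).
Proof.
move=> pZ0 b0 Zb ZV eps0 bD VD.
have D0 : 0 < D by apply: le_lt_trans bD; rewrite divr_ge0// mulr_ge0// ltW.
(* [lam] minimises the exponent [- lam * eps + lam ^ 2 * D / 2]. *)
pose lam := eps / D.
have lam0 : 0 <= lam by rewrite divr_ge0// ltW.
have lamb : lam * b / 3 < 1.
  rewrite (_ : lam * b / 3 = b * eps / 3 / D); first by rewrite ltr_pdivrMr// mul1r.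
  by rewrite /lam; field; rewrite gt_eqF.
have g0 : 0 < 1 - lam * b / 3 by rewrite subr_gt0.
have pLZ0 : \sum_l p l *: (lam *: Z l) = 0.
  under eq_bigr do rewrite scalerA mulrC -scalerA.
  by rewrite -scaler_sumr pZ0 scaler0.
have nlam x : frob_norm (lam *: x : 'M[R]_(m, n)) = lam * frob_norm x.
  by rewrite frob_normZ ger0_norm.
have remainder l : expR (frob_norm (lam *: Z l)) - frob_norm (lam *: Z l)
    <= 1 + (lam ^+ 2 / 2 / (1 - lam * b / 3)) * frob_norm (Z l) ^+ 2.
  rewrite nlam; set t := lam * _.
  have t0 : 0 <= t by rewrite mulr_ge0// frob_norm_ge0.
  have tb : t <= lam * b by rewrite ler_wpM2l.
  have t3 : t < 3 by lra.
  have := expR_remainder_le t0 t3.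
  have : t ^+ 2 / 2 / (1 - t / 3) <= t ^+ 2 / 2 / (1 - lam * b / 3).
    apply: ler_wpM2l; first by rewrite divr_ge0// sqr_ge0.
    by rewrite lef_pV2 ?posrE//; lra.
  rewrite [in X in _ <= X -> _](_ : t ^+ 2 / 2 / (1 - lam * b / 3)
    = (lam ^+ 2 / 2 / (1 - lam * b / 3)) * frob_norm (Z l) ^+ 2).
    by lra.
  by rewrite /t exprMn; field; rewrite gt_eqF//; lra.
have qle : \sum_l p l * (expR (frob_norm (lam *: Z l)) - frob_norm (lam *: Z l))
    <= expR (eps ^+ 2 / (2 * D)).
  apply: le_trans (ler_sum _ (fun l _ => ler_wpM2l (p0 l) (remainder l))) _.
  under eq_bigr do rewrite mulrDr mulr1 mulrCA.
  rewrite big_split/= p1 -mulr_sumr; apply: le_trans (expR_ge1Dx _); rewrite lerD2l.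
  apply: (@le_trans _ _ (lam ^+ 2 / 2 / (1 - lam * b / 3) * (D * (1 - lam * b / 3)))).
    apply: ler_wpM2l; first by rewrite !divr_ge0// ?sqr_ge0// ltW.
    apply: (le_trans ZV).
    rewrite (_ : D * _ = D - b * eps / 3); first by lra.
    by rewrite /lam; field; rewrite gt_eqF.
  have -> // : forall g, g != 0 -> lam ^+ 2 / 2 / g * (D * g) = eps ^+ 2 / (2 * D).
    by move=> g gn; rewrite /lam; field; rewrite gn gt_eqF.
  by rewrite gt_eqF.
pose ex := expR (c%:R * eps ^+ 2 / D).
have := mean_cosh_iid_sum p0 pLZ0 c 0.
rewrite frob_norm0 cosh0 mul1r => mean.
have q0 : 0 <= \sum_l p l * (expR (frob_norm (lam *: Z l)) - frob_norm (lam *: Z l)).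
  apply: sumr_ge0 => l _; apply: mulr_ge0 => //; rewrite subr_ge0.
  by apply: le_trans (expR_ge1Dx _); rewrite lerDr.
have {qle} := le_trans mean (lerXn2r c q0 (expR_ge0 _) qle).
rewrite -expRM_natl => {}mean.
have markov : (\sum_(f : {ffun 'I_c -> K} | c%:R * eps < frob_norm (\sum_i Z (f i)))
     \prod_i p (f i)) * (ex / 2) <= expR (c%:R * (eps ^+ 2 / (2 * D))).
  apply: le_trans mean.
  rewrite mulr_suml big_mkcond; apply: ler_sum => f _.
  case: ifPn => [far|_]; last by rewrite mulr_ge0 ?prodr_ge0// ltW// cosh_gt0.
  apply: ler_wpM2l; first exact: prodr_ge0.
  apply: le_trans (expR_half_le_cosh _) _.
  rewrite add0r -scaler_sumr nlam; apply: le_cosh.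
    by rewrite divr_ge0 ?mulr_ge0 ?sqr_ge0// ltW.
  rewrite (_ : _ / D = lam * (c%:R * eps)); first by rewrite ler_wpM2l// ltW.
  by rewrite /lam; field; rewrite gt_eqF.
have ex0 : 0 < ex / 2 by rewrite divr_gt0// expR_gt0.
rewrite -(ler_pM2r ex0); apply: (le_trans markov).
rewrite (_ : 2 * ?[e] * (ex / 2) = ?e * ex) => [|]; last by field.
rewrite /ex -expRD ler_expR.
by rewrite le_eqVlt; apply/orP; left; apply/eqP; field; rewrite gt_eqF.
Qed.

(** The samples [W l / p l] have mean [mu = \sum_l W l], so the second moment of
    the centred ones is [v - |mu| ^ 2].  The parameter [D] is left free above its
    smallest value because that value may be 0, in which case the quotient
    would take the value 0. *)
Lemma importance_sampling_tail (W : K -> 'M[R]_(m, n)) c (u eps D : R) :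
  (forall l, 0 < p l) -> 0 < eps -> (forall l, (p l)^-1 * frob_norm (W l) <= u) ->
  2 * (\sum_l (p l)^-1 * frob_norm (W l) ^+ 2) + eps * u <= D ->
  \sum_(f : {ffun 'I_c -> K} | c%:R * eps <
      frob_norm (\sum_i ((p (f i))^-1 *: W (f i) - \sum_l W l))) \prod_i p (f i)
  <= 2 * expR (- (c%:R * eps ^+ 2 / D)).
Proof.
move=> pp eps0 Wu; set v := \sum_l _ * _ ^+ 2 => vD.
set mu := \sum_l W l; set a := frob_norm mu.
have pn l : p l != 0 by rewrite gt_eqF.
pose Y l := (p l)^-1 *: W l.
have nY l : frob_norm (Y l) = (p l)^-1 * frob_norm (W l).
  by rewrite frob_normZ ger0_norm// invr_ge0.
have pY : \sum_l p l *: Y l = mu.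
  by apply: eq_bigr => l _; rewrite scalerA divff// scale1r.
have a0 : 0 <= a := frob_norm_ge0 mu.
have au : a <= u.
  rewrite /a -pY; apply: (le_trans (ler_frob_norm_sum _)).
  rewrite -[u]mul1r -p1 mulr_suml; apply: ler_sum => l _.
  by rewrite frob_normZ ger0_norm// ler_wpM2l// nY.
pose Z l := Y l - mu.
have pZ0 : \sum_l p l *: Z l = 0.
  under eq_bigr do rewrite scalerBr.
  by rewrite sumrB pY -scaler_suml p1 scale1r subrr.
have Zau l : frob_norm (Z l) <= u + a.
  by apply: (le_trans (ler_frob_normD _ _)); rewrite frob_normN lerD2r nY.
have varZ : \sum_l p l * frob_norm (Z l) ^+ 2 = v - a ^+ 2.
  transitivity (v - 2 * frob_dot mu (\sum_l p l *: Y l) + (\sum_l p l) * a ^+ 2).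
    rewrite frob_dot_sumr mulr_sumr -sumrB mulr_suml -big_split; apply: eq_bigr => l _ /=.
    rewrite sqr_frob_normD frob_normN -(scaleN1r mu) frob_dotZr [frob_dot (Y l) _]frob_dotC.
    by rewrite (frob_dotZr (p l)) nY /a; field; exact: pn.
  by rewrite pY p1 -sqr_frob_norm -/a; ring.
have va : a ^+ 2 <= v.
  by rewrite -subr_ge0 -varZ; apply: sumr_ge0 => l _; rewrite mulr_ge0// sqr_ge0.
have [small|large] := ltP eps (u + a); last first.
  rewrite big1 ?mulr_ge0 ?expR_ge0// => f; rewrite ltNge => /negP[].
  apply: (le_trans (ler_frob_norm_sum _)).
  have : \sum_(i < c) frob_norm (Z (f i)) <= \sum_(i < c) eps.
    by apply: ler_sum => i _; apply: le_trans large.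
  by rewrite sumr_const card_ord mulr_natl.
have u0 : 0 < u by lra.
have := @iid_sum_tail Z c (v - a ^+ 2) (u + a) (D / 2) eps pZ0.
rewrite (_ : 2 * (D / 2) = D); last by field.
(* These two inequalities are the admissibility of [D / 2] in [iid_sum_tail]:
   [(u + a) * eps / 3] exceeds [eps * u / 2] by [eps * (2 * a - u) / 6], and
   [eps] is smaller than [u + a]. *)
have slack : eps * (2 * a - u) <= 2 * a ^+ 2.
  have [au2|au2] := leP (2 * a) u.
    have : 0 <= eps * (u - 2 * a) by rewrite mulr_ge0 ?subr_ge0// ltW.
    by have := sqr_ge0 a; lra.
  have : 0 <= (u + a - eps) * (2 * a - u) by rewrite mulr_ge0// subr_ge0 ltW.
  have : 0 <= u * (u - a) by rewrite mulr_ge0 ?subr_ge0// ltW.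
  by lra.
have strict : eps * (2 * a - u) < 6 * v.
  have [a_eq0|an0] := eqVneq a 0.
    have : 0 < eps * u by rewrite mulr_gt0.
    by move: va; rewrite a_eq0; lra.
  have : 0 < a ^+ 2 by rewrite exprn_even_gt0.
  by lra.
have sqa : 0 <= a ^+ 2 := sqr_ge0 a.
apply => //; [by rewrite addr_ge0// ltW|by rewrite varZ|by lra|by lra].
Qed.

End Tail.

(** * The law of the samples *)

Section Probability.
Variables (d : measure_display) (T : measurableType d) (R : realType).
Variables (P : probability T R) (k c : nat) (p : 'I_k -> R) (r : 'I_c -> T -> 'I_k).

(** The event is the disjoint union, over the outcomes [f] satisfying [Q], of the
    events that all the samples agree with [f]; independence gives the
    probability of each. *)
Lemma iid_samples_probability (Q : pred {ffun 'I_c -> 'I_k}) :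
  iid_samples P p r ->
  P [set w | Q [ffun i => r i w]]%classic = (\sum_(f | Q f) \prod_i p (f i))%:E.
Proof.
move=> [mr law indep].
pose F (f : {ffun 'I_c -> 'I_k}) :=
  (\bigcap_(i in [set` [set: 'I_c]%SET]) (r i @^-1` [set f i]))%classic.
have FE f w : F f w <-> f = [ffun i => r i w].
  split=> [h|->]; last by move=> i _; rewrite /= ffunE.
  by apply/ffunP => i; rewrite ffunE; apply/esym/h; rewrite /= inE.
have -> : [set w | Q [ffun i => r i w]]%classic = (\bigcup_(f in [set` Q]) F f)%classic.
  apply/seteqP; split=> w /=.
    by move=> Qw; exists [ffun i => r i w] => //; apply/FE.
  by move=> [f Qf /FE fE]; rewrite -fE.
rewrite measure_fin_bigcup.
- rewrite -(@bigfs _ _ _ _ (index_enum _)) ?index_enum_uniq//; last first.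
    by move=> f _; rewrite mem_index_enum.
  rewrite -sumEFin; apply: eq_bigr => f _.
  rewrite [LHS]indep -prodEFin.
  by rewrite (eq_bigl xpredT) => [|i]; [apply: eq_bigr => i _; rewrite law|rewrite inE].
- exact: finite_finset.
- by move=> f g _ _ [w [/FE -> /FE ->]].
- move=> f _; apply: fin_bigcap_measurable => //; exact: mr.
Qed.

End Probability.

(** * The sampled product *)

Section Blocks.
Variables (R : realType) (m n rho k : nat) (A : 'M[R]_(m, n)) (B : 'M[R]_(n, rho)).

(** The entry of a product is a sum over the inner index, which is cut along the
    blocks of the partition. *)
Lemma sum_blockprod (Theta : 'I_k -> {set 'I_n}) : block_partition Theta ->
  \sum_l blockprod A B (Theta l) = A *m B.
Proof.
move=> [injT partT]; apply/matrixP => i j; rewrite summxE mxE.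
transitivity (\sum_(t in [set: 'I_n]%SET) A i t * B t j); last first.
  by apply: eq_bigl => t; rewrite inE.
rewrite (set_partition_big _ partT) big_imset /=; last by move=> x y _ _; exact: injT.
rewrite [RHS](eq_bigl xpredT) => [|l]; last by rewrite inE.
apply: eq_bigr => l _; rewrite big_enum_val mxE; apply: eq_bigr => t _.
by rewrite !mxE.
Qed.

End Blocks.

Unset Implicit Arguments.

Theorem proposition2p6 (R : realType) (m n rho k c : nat)
    (A : 'M[R]_(m, n)) (B : 'M[R]_(n, rho))
    (Theta : 'I_k -> {set 'I_n}) (hTheta : block_partition Theta)
    (p : 'I_k -> R) (hp : sampling_prob p)
    (hc : (1 <= c)%N)
    (d : measure_display) (T : measurableType d) (P : probability T R)
    (r : 'I_c -> T -> 'I_k) (hr : iid_samples P p r)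
    (eps : R) (heps : 0 < eps) :
  (P [set w : T |
       (eps < spec_norm (Shat A B Theta p (fun i => r i w) - A *m B))%R]%classic
   <= ((m + rho)%:R *
       expR (- (c%:R * eps ^+ 2 /
         (2 * (spec_norm (A *m B) ^+ 2
               + 2 * Msum A B Theta * spec_norm (A *m B)
               + U2 A B Theta p)
          + eps * (spec_norm (A *m B) + U1 A B Theta p)))))%R%:E)%E.
Proof.
have [pp p1] := hp; have p0 l : 0 <= p l by exact: ltW.
pose far (f : {ffun 'I_c -> 'I_k}) := eps < spec_norm (Shat A B Theta p f - A *m B).
have -> : [set w | eps < spec_norm (Shat A B Theta p (fun i => r i w) - A *m B)]%classic
    = [set w | far [ffun i => r i w]]%classic.
  have rE w : ([ffun i => r i w] : 'I_c -> 'I_k) = (fun i => r i w).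
    by apply/funext => i; rewrite ffunE.
  by apply/seteqP; split=> w; rewrite /= /far rE.
rewrite (iid_samples_probability _ hr) lee_fin.
pose Z (f : {ffun 'I_c -> 'I_k}) i :=
  (p (f i))^-1 *: blockprod A B (Theta (f i)) - \sum_l blockprod A B (Theta l).
have cn0 : c%:R != 0 :> R by rewrite pnatr_eq0 -lt0n.
have cp : 0 < c%:R :> R by rewrite ltr0n.
have ShatE (f : {ffun 'I_c -> 'I_k}) : Shat A B Theta p f - A *m B = c%:R^-1 *: \sum_i Z f i.
  rewrite /Z sumrB sumr_const card_ord scalerBr
    -(scaler_nat c (\sum_l _)) [_ *: (c%:R *: _)]scalerA mulVf// scale1r.
  by rewrite sum_blockprod.
have farZ f : far f -> c%:R * eps < frob_norm (\sum_i Z f i).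
  move=> ff; have := lt_le_trans ff (spec_norm_le_frob _).
  rewrite ShatE frob_normZ ger0_norm ?invr_ge0// => h.
  by rewrite mulrC -ltr_pdivlMr// mulrC.
(* A deviation forces both dimensions to be positive, so that [2 <= m + rho]. *)
have dim f : far f -> (0 < m)%N /\ (0 < rho)%N.
  move=> /farZ; have ceps : 0 < c%:R * eps by rewrite mulr_gt0.
  move=> h; suff : frob_norm (\sum_i Z f i) != 0.
    have inhab s (i : 'I_s) : (0 < s)%N by exact: leq_ltn_trans (ltn_ord i).
    have [m0|mp] := posnP m; last have [rho0|//] := posnP rho; move=> /eqP [];
      rewrite /frob_norm big1 ?sqrtr0// => i _.
      by exfalso; move: (inhab _ i); rewrite m0.
    by rewrite big1// => j _; exfalso; move: (inhab _ j); rewrite rho0.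
  by rewrite gt_eqF// (lt_trans ceps).
have Wu l : (p l)^-1 * frob_norm (blockprod A B (Theta l)) <= U1 A B Theta p.
  exact: (le_bigmax _ _ l).
set D := (X in _ / X).
have UD : 2 * U2 A B Theta p + eps * U1 A B Theta p <= D.
  have AB0 := spec_norm_ge0 (A *m B).
  have M0 : 0 <= Msum A B Theta by apply: sumr_ge0 => l _; exact: frob_norm_ge0.
  have : 0 <= Msum A B Theta * spec_norm (A *m B) by exact: mulr_ge0.
  have : 0 <= eps * spec_norm (A *m B) by rewrite mulr_ge0// ltW.
  by have := sqr_ge0 (spec_norm (A *m B)); rewrite /D; lra.
have tail := importance_sampling_tail p0 p1 c pp heps Wu UD.
have {}tail : \sum_(f | far f) \prod_i p (f i) <= 2 * expR (- (c%:R * eps ^+ 2 / D)).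
  apply: le_trans tail; rewrite big_mkcond [leRHS]big_mkcond; apply: ler_sum => f _.
  case: ifPn => [/farZ ->//|_]; case: ifP => // _; exact: prodr_ge0.
have [/existsP [f0 /dim [mp rp]]|nofar] := boolP [exists f, far f]; last first.
  rewrite big1 ?mulr_ge0 ?expR_ge0// => f ff.
  by move: nofar => /existsPn/(_ f); rewrite ff.
apply: (le_trans tail); apply: ler_wpM2r; first exact: expR_ge0.
by rewrite ler_nat (leq_add mp rp).
Qed.
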